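(* Let $X_1$ and $X_2$ be two independent symmetric real random variables, each with mean $0$ and variance $1$, such that the random variables $X_1 + X_2$ and $X_1 - X_2$ are independent. Then both $X_1$ and $X_2$ follow a normal distribution.
   Context: $X_1$ and $X_2$ are real-valued random variables defined on a common probability space. A real random variable $X$ is called symmetric if $X$ and $-X$ have the same distribution. *)

(* Defs.v *)
From HB Require Import structures.
From mathcomp Require Import all_boot all_order all_algebra.
From mathcomp Require Import all_classical all_reals all_analysis.
(* not re-exported by [all_analysis]; makes [\- X], [X \+ Y], [X \- Y]
   random variables *)
From mathcomp Require Import measurable_realfun.

Set Implicit Arguments.
Unset Strict Implicit.
Unset Printing Implicit Defensive.

Import Order.TTheory GRing.Theory Num.Theory.
Import numFieldNormedType.Exports.

Local Open Scope classical_set_scope.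
Local Open Scope ring_scope.

(* Laws are compared on measurable sets only: [distribution P X] is a total
   set function, with unspecified values on non-measurable sets. *)
Definition same_law (R : realType) (mu nu : set R -> \bar R) : Prop :=
  forall A : set R, measurable A -> mu A = nu A.

Definition symmetric_rv d (T : measurableType d) (R : realType)
    (P : probability T R) (X : {RV P >-> R}) : Prop :=
  same_law (distribution P X) (distribution P (\- X : {RV P >-> R})).

Definition independent_rv d (T : measurableType d) (R : realType)
    (P : probability T R) (X Y : {RV P >-> R}) : Prop :=
  forall A B : set R, measurable A -> measurable B ->
    P (X @^-1` A `&` Y @^-1` B) = (P (X @^-1` A) * P (Y @^-1` B))%E.

(* [s] is the standard deviation. [0 < s] matters: for [s = 0] the library's
   [normal_prob m s] is the uniform law on [[0, 1]], not a Gaussian. *)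
Definition normal_rv d (T : measurableType d) (R : realType)
    (P : probability T R) (X : {RV P >-> R}) : Prop :=
  exists m s : R, 0 < s /\ same_law (distribution P X) (normal_prob m s).

(* [P] cannot be inferred from [X], since [{RV P >-> R}] unfolds to
   [{mfun T >-> R}]. *)
Arguments symmetric_rv {d T R} P X.
Arguments independent_rv {d T R} P X Y.
Arguments normal_rv {d T R} P X.

(* Main.v *)
Require Import Defs.
From HB Require Import structures.
From mathcomp Require Import all_boot all_order all_algebra.
From mathcomp Require Import all_classical all_reals all_analysis measurable_realfun.
From mathcomp Require Import ring lra.

Set Implicit Arguments.
Unset Strict Implicit.
Unset Printing Implicit Defensive.

Import Order.TTheory GRing.Theory Num.Theory.
Import numFieldNormedType.Exports.

Local Open Scope classical_set_scope.
Local Open Scope ring_scope.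

(** Put [U = X1 + X2] and [V = X1 - X2].  Since [X1 = (U + V) / 2] and
    [X2 = (U - V) / 2] with [U], [V] independent, and since by symmetry of [X1]
    and [X2] the three variables [U], [V], [- V] have the same law (the
    convolution of the laws of [X1] and [X2]), [X1] and [X2] have one common
    law [mu], and [mu] is the law of [(Y1 + Y2 + Y3 + Y4) / 2] for independent
    [Yi] of law [mu] (lemma [quartering_law]).  A centred Gaussian law has the
    same property: it is the law of [(Y1 + Y2) / c] with [c ^+ 2 = 2], by
    rotation invariance, and this is used twice (lemma [quartering_gauss]).

    It remains to see that there is only one law on the line with this property,
    mean 0 and variance 1 (theorem [standardized_quartering_unique]).  This is
    the central limit theorem, proved by the operator method of Lindeberg and
    Trotter: no characteristic functions are involved.  To a law [m] and a scale
    [h] attach the operator [avg m h], which maps [f] to the function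
    [x |-> E f (x + h Y)], [Y] of law [m].  These operators commute, are
    monotone and preserve constants, and the property above says that
    [avg m h] is the fourth power of [avg m (h / 2)].  Hence a uniform bound
    [c] for the difference of [avg m1 (h / 2) f] and [avg m2 (h / 2) f] gives
    the bound [4 * c] at scale [h] (lemma [avg_le_quadruple]), and going down to
    scale [2 ^- n] costs a factor [4 ^+ n].  On the other hand [avg m h f] is
    [f + h ^+ 2 / 2 * f''] up to [o(h ^+ 2)], uniformly in the point, whatever
    the standardized law [m] (lemma [avg_taylor]); with [h = 2 ^- n] the factor
    [4 ^+ n] is absorbed, so [m1] and [m2] give the same integral to every bounded
    [f] with a bounded Lipschitz second derivative.  The functions [atan (a * x + b)] suffice: they converge boundedly to
    indicators of half-lines, and half-lines determine a law. *)

(** * Averaging operators on the line *)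

Section averaging.
Context {R : realType}.
Local Open Scope ereal_scope.
Implicit Types (m : probability (measurableTypeR R) R) (f g : R -> \bar R).

(** Nonnegative functions with values in the extended reals are used throughout:
    Tonelli's theorem then applies without integrability conditions. *)
Definition avg m (h : R) f (x : R) : \bar R := \int[m]_y f (x + h * y)%R.

Lemma avg_ge0 m h f : (forall x, 0 <= f x) -> forall x, 0 <= avg m h f x.
Proof. by move=> f0 x; apply: integral_ge0. Qed.

Lemma measurable_shift_scale f (h x : R) : measurable_fun [set: R] f ->
  measurable_fun [set: R] (fun y : R => f (x + h * y)%R).
Proof.
move=> mf; apply: measurableT_comp => //=.
by apply: measurable_funD => //; exact: measurable_funM.
Qed.

Lemma measurable_shift_scale2 f (h : R) : measurable_fun [set: R] f ->
  measurable_fun [set: R * R] (fun z => f (z.1 + h * z.2)%R).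
Proof.
move=> mf; apply: measurableT_comp => //=.
by apply: measurable_funD => //; apply: measurable_funM.
Qed.

Lemma measurable_avg m h f : measurable_fun [set: R] f ->
  (forall x, 0 <= f x) -> measurable_fun [set: R] (avg m h f).
Proof.
move=> mf f0.
apply: (@measurable_fun_fubini_tonelli_F _ _ (measurableTypeR R) (measurableTypeR R) R
  m (fun z : measurableTypeR R * measurableTypeR R => f (z.1 + h * z.2)%R)) => //.
exact: measurable_shift_scale2.
Qed.

Lemma avg_le_addr m h f g (c : R) : (0 <= c)%R ->
  measurable_fun [set: R] f -> (forall x, 0 <= f x) ->
  measurable_fun [set: R] g -> (forall x, 0 <= g x) ->
  (forall x, f x <= g x + c%:E) -> forall x, avg m h f x <= avg m h g x + c%:E.
Proof.
move=> c0 mf f0 mg g0 fg x; rewrite /avg.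
have mg' := measurable_shift_scale h x mg.
have mf' := measurable_shift_scale h x mf.
have -> : c%:E = \int[m]_y (cst c%:E y).
  by rewrite integral_cst//= probability_setT mule1.
rewrite -ge0_integralD//.
apply: ge0_le_integral => //.
exact: emeasurable_funD.
Qed.

(** Both sides are the integral of [f (x + h * y + k * z)] for the product law. *)
Lemma avgC m1 m2 h k f : measurable_fun [set: R] f -> (forall x, 0 <= f x) ->
  forall x, avg m1 h (avg m2 k f) x = avg m2 k (avg m1 h f) x.
Proof.
move=> mf f0 x.
pose F (z : measurableTypeR R * measurableTypeR R) := f (x + h * z.1 + k * z.2)%R.
have mF : measurable_fun setT F.
  apply: measurableT_comp => //.
  apply: measurable_funD; last by apply: measurable_funM.
  by apply: measurable_funD => //; apply: measurable_funM.
have F0 z : 0 <= F z by exact: f0.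
transitivity (\int[m1]_y \int[m2]_z F (y, z)); first by [].
rewrite (@fubini_tonelli _ _ (measurableTypeR R) (measurableTypeR R) R m1 m2 F mF F0).
apply: eq_integral => y _; apply: eq_integral => z _.
by rewrite /F/= addrAC.
Qed.

(** In terms of random variables: [m] is the law of [(Y1 + Y2 + Y3 + Y4) / 2],
    where [Y1], [Y2], [Y3], [Y4] are independent with law [m]. *)
Definition quartering m := forall h f, measurable_fun [set: R] f ->
  (forall x, 0 <= f x) -> avg m h f = iter 4 (avg m (h / 2)) f.

(** Writing [T] and [G] for the operators of [m1] and [m2] at scale [h / 2], the
    factors of [T ^ 4] are replaced one at a time by [G]; by commutation each
    replacement compares [T f] with [G f] inside a product of averaging
    operators, which do not increase a uniform error, and so costs [c]. *)
Lemma avg_le_quadruple m1 m2 h f (c : R) : quartering m1 -> quartering m2 ->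
  (0 <= c)%R -> measurable_fun [set: R] f -> (forall x, 0 <= f x) ->
  (forall x, avg m1 (h / 2) f x <= avg m2 (h / 2) f x + c%:E) ->
  forall x, avg m1 h f x <= avg m2 h f x + (4 * c)%:E.
Proof.
move=> q1 q2 c0 mf f0 fc x; rewrite q1// q2//.
set T := avg m1 (h / 2); set G := avg m2 (h / 2).
pose nice g := measurable_fun [set: R] g /\ forall x, 0 <= g x.
have nT g : nice g -> nice (T g).
  by move=> [mg g0]; split; [exact: measurable_avg|exact: avg_ge0].
have nG g : nice g -> nice (G g).
  by move=> [mg g0]; split; [exact: measurable_avg|exact: avg_ge0].
have nf : nice f by [].
have TGC g : nice g -> T (G g) = G (T g).
  by move=> [mg g0]; apply/funext => y; exact: avgC.
have Tadd g k c' : (0 <= c')%R -> nice g -> nice k ->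
    (forall y, g y <= k y + c'%:E) -> forall y, T g y <= T k y + c'%:E.
  by move=> c'0 [mg g0] [mk k0] gk y; exact: avg_le_addr.
have Gadd g k c' : (0 <= c')%R -> nice g -> nice k ->
    (forall y, g y <= k y + c'%:E) -> forall y, G g y <= G k y + c'%:E.
  by move=> c'0 [mg g0] [mk k0] gk y; exact: avg_le_addr.
have step k : forall y, iter k.+1 T f y <= iter k.+1 G f y + (k.+1%:R * c)%:E.
  elim: k => [|k IH] y; first by rewrite mul1r; exact: fc.
  have nk j : nice (iter j G f) by elim: j => //= j; exact: nG.
  have nk' j : nice (iter j T f) by elim: j => //= j; exact: nT.
  have TG : forall y, T (iter k.+1 G f) y <= iter k.+2 G f y + c%:E.
    elim: k.+1 => [|j IHj] z; first exact: fc.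
    rewrite [iter j.+1 G f]iterS TGC// [iter j.+2 G f]iterS.
    by apply: Gadd => //; exact: nT.
  have kc0 : (0 <= k.+1%:R * c)%R by rewrite mulr_ge0.
  apply: le_trans (Tadd _ _ _ kc0 (nk' _) (nk _) IH y) _.
  by rewrite -[k.+2]add1n natrD mulrDl mul1r EFinD addeA leeD2r.
exact: (step 3%N).
Qed.

End averaging.

(** * Taylor expansion of order two *)

Section taylor.
Context {R : realType}.

Lemma normr_le_of_derive (f f1 : R -> R) (x B : R) :
  (forall y : R, is_derive y 1 f (f1 y)) -> f 0 = 0 ->
  (forall y, `|y| <= `|x| -> `|f1 y| <= B) -> `|f x| <= B * `|x|.
Proof.
move=> df f00 f1B.
have cf (a b : R) : {within `[a, b], continuous f}.
  by apply: derivable_within_continuous => z _; exact: ex_derive.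
have [x0|/ltW x0] := leP 0 x.
  have [c] := MVT_segment x0 (fun y _ => df y) (@cf 0 x).
  rewrite in_itv/= => /andP[c0 cx]; rewrite f00 !subr0 => ->.
  by rewrite normrM ler_wpM2r// f1B// !ger0_norm.
have [c] := MVT_segment x0 (fun y _ => df y) (@cf x 0).
rewrite in_itv/= => /andP[xc c0]; rewrite f00 !sub0r => fx.
rewrite -normrN fx normrM normrN ler_wpM2r// f1B//.
by rewrite !ler0_norm// lerN2.
Qed.

(** The minimum makes the remainder both [O(z ^+ 3)] and [O(z ^+ 2)].  The first
    gives the rate at small scale; the second makes it integrable against a law
    that has no third moment. *)
Lemma taylor2_le (f f1 f2 : R -> R) (K x z : R) :
  (forall y : R, is_derive y 1 f (f1 y)) -> (forall y : R, is_derive y 1 f1 (f2 y)) ->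
  (forall y y', `|f2 y - f2 y'| <= K * Num.min `|y - y'| 1) ->
  `|f (x + z) - (f x + z * f1 x + z ^+ 2 / 2 * f2 x)| <=
     K * (z ^+ 2 * Num.min `|z| 1).
Proof.
move=> df df1 f2K.
have K0 : 0 <= K.
  have := f2K 1 0; rewrite subr0 normr1 minxx mulr1.
  exact: le_trans.
have dshift (g g' : R -> R) (y : R) : (forall y : R, is_derive y 1 g (g' y)) ->
    is_derive y 1 (fun t => g (x + t)) (g' (x + y)).
  move=> dg.
  have dx : is_derive y 1 (fun t : R => x + t) 1.
    by apply: is_derive_eq; rewrite add0r mulr1.
  by have := is_derive1_comp (dg (x + y)) dx; rewrite mulr1.
pose phi t := f (x + t) - f x - (t * f1 x + t ^+ 2 / 2 * f2 x).
pose psi t := f1 (x + t) - f1 x - t * f2 x.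
have dphi (y : R) : is_derive y 1 phi (psi y).
  have dfx := dshift f f1 y df.
  apply: is_derive_eq.
  by rewrite /phi /psi /GRing.scale/=; field.
have dpsi (y : R) : is_derive y 1 psi (f2 (x + y) - f2 x).
  have dfx := dshift f1 f2 y df1.
  apply: is_derive_eq.
  by rewrite /phi /psi /GRing.scale/=; field.
have psiB y : `|y| <= `|z| -> `|psi y| <= K * Num.min `|z| 1 * `|z|.
  move=> yz; apply: (@le_trans _ _ (K * Num.min `|z| 1 * `|y|)); last first.
    by rewrite ler_wpM2l// mulr_ge0// le_min normr_ge0 ler01.
  apply: (@normr_le_of_derive psi _ y _ dpsi).
    by rewrite /psi addr0 mul0r !subrr.
  move=> t ty; apply: le_trans (f2K _ _) _.
  rewrite ler_wpM2l// addrAC subrr add0r le_min !ge_min.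
  by rewrite (le_trans ty yz) lexx orbT.
have := @normr_le_of_derive phi psi z _ dphi _ psiB.
rewrite /phi addr0 mul0r subrr expr0n/= !mul0r addr0 subr0 => /(_ erefl).
rewrite opprD.
have -> : K * (z ^+ 2 * Num.min `|z| 1) = K * Num.min `|z| 1 * `|z| * `|z|.
  by rewrite -[z ^+ 2]real_normK ?num_real//; ring.
by rewrite !opprD !addrA.
Qed.
End taylor.

(** * Test functions *)

Section sigmoid.
Context {R : realType}.

(* [- 2 * psi] is the second derivative of [atan]. *)
Let psi (u : R) := u / (1 + u ^+ 2) ^+ 2.

Lemma atan_curvature_modulus (u v : R) :
  `|psi u - psi v| <= 2 * Num.min `|u - v| 1.
Proof.
set A := 1 + u ^+ 2; set B := 1 + v ^+ 2.
have A1 : 1 <= A by rewrite /A; nra.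
have B1 : 1 <= B by rewrite /B; nra.
have A0 : 0 < A by lra.
have B0 : 0 < B by lra.
have lipschitz t : `|t| <= A * B -> `|(u - v) * t / (A * B)| <= `|u - v|.
  move=> tAB; rewrite -mulrA normrM ler_piMr// normrM normfV.
  by rewrite (gtr0_norm (mulr_gt0 A0 B0)) ler_pdivrMr ?mulr_gt0// mul1r.
have pB (t : R) : `|t / (1 + t ^+ 2)| <= 1.
  have t1 : 0 < 1 + t ^+ 2 by nra.
  rewrite normrM normfV (gtr0_norm t1) ler_pdivrMr// mul1r ler_norml.
  by apply/andP; split; nra.
have iB (t : R) : `|(1 + t ^+ 2)^-1| <= 1.
  have t1 : 1 <= 1 + t ^+ 2 by nra.
  by rewrite normfV invf_le1 ?ger0_norm//; lra.
have psiE t : psi t = t / (1 + t ^+ 2) * (1 + t ^+ 2)^-1.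
  by rewrite /psi expr2 invfM mulrA.
have psi1 t : `|psi t| <= 1 by rewrite psiE normrM mulr_ile1.
rewrite minr_pMr// le_min; apply/andP; split; last first.
  by rewrite mulr1; apply: le_trans (ler_normB _ _) _; rewrite lerD.
(* [psi] is the product of [t / (1 + t ^+ 2)] and [1 / (1 + t ^+ 2)], which are
   both 1-Lipschitz and bounded by 1. *)
have -> : psi u - psi v = u / A * ((u - v) * (- (u + v)) / (A * B)) +
                          (u - v) * (1 - u * v) / (A * B) * B^-1.
  by rewrite /psi /A /B; field; rewrite -/A -/B !lt0r_neq0.
have AB : A * B = 1 + u ^+ 2 + v ^+ 2 + (u * v) ^+ 2 by rewrite /A /B; ring.
have := (sqr_ge0 u, sqr_ge0 v, sqr_ge0 (u * v), sqr_ge0 (u - v), sqr_ge0 (u + v)).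
have := (sqr_ge0 (u - 1), sqr_ge0 (v - 1), sqr_ge0 (u + 1), sqr_ge0 (v + 1)).
move=> [[[H1 H2] H3] H4] [[[[H5 H6] H7] H8] H9].
rewrite mulr_natl mulr2n; apply: le_trans (ler_normD _ _) _; apply: lerD.
  rewrite normrM -[leRHS]mul1r ler_pM// ?pB// lipschitz// normrN ler_norml.
  by apply/andP; split; rewrite AB; lra.
rewrite normrM -[leRHS]mulr1 ler_pM// ?iB// lipschitz// ler_norml.
by apply/andP; split; rewrite AB; lra.
Qed.

(** The shift by [pi / 2] makes the function nonnegative. *)
Definition sigmoid (a b x : R) : R := atan (a * x + b) + pi / 2.

Lemma sigmoid_ge0 a b x : 0 <= sigmoid a b x.
Proof. by rewrite -lerBlDr sub0r ltW// atan_gtNpi2. Qed.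

Lemma sigmoid_le_pi a b x : sigmoid a b x <= pi.
Proof. by rewrite /sigmoid -lerBrDr; have := atan_ltpi2 (a * x + b); lra. Qed.

Lemma continuous_sigmoid a b : continuous (sigmoid a b).
Proof.
move=> x; apply: cvgD; last exact: cvg_cst.
apply: (continuous_comp (f := fun x => a * x + b)); last exact: continuous_atan.
by apply: cvgD; [exact: mulrl_continuous|exact: cvg_cst].
Qed.

Lemma sigmoid_taylor2 a b : exists f1 f2 : R -> R, exists2 K : R, 0 <= K &
  forall x z, `|sigmoid a b (x + z) -
                (sigmoid a b x + z * f1 x + z ^+ 2 / 2 * f2 x)| <=
     K * (z ^+ 2 * Num.min `|z| 1).
Proof.
have a20 : 0 <= 2 * a ^+ 2 by rewrite pmulr_rge0// sqr_ge0.
pose f1 (x : R) := a * (1 + (a * x + b) ^+ 2)^-1.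
pose f2 x := - (2 * a ^+ 2) * psi (a * x + b).
exists f1, f2; exists (4 * a ^+ 2 * (`|a| + 1)).
  by rewrite mulr_ge0 ?addr_ge0// pmulr_rge0// sqr_ge0.
have dlin (x : R) : is_derive x 1 (fun x : R => a * x + b) a.
  by apply: is_derive_eq; rewrite /GRing.scale/=; ring.
move=> x z; apply: (@taylor2_le _ _ f1 f2) => [y|y|y y'].
- by apply: is_derive_eq; rewrite addr0 mulrC.
- have n0 : 1 + (a * y + b) ^+ 2 != 0 by rewrite lt0r_neq0// ltr_pwDl ?sqr_ge0.
  by apply: is_derive_eq; rewrite /f2 /psi /GRing.scale/=; field.
rewrite /f2 -mulrBr normrM normrN (ger0_norm a20).
apply: (@le_trans _ _ (2 * a ^+ 2 * (2 * Num.min `|a * (y - y')| 1))).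
  rewrite ler_wpM2l//.
  have -> : a * (y - y') = a * y + b - (a * y' + b) by ring.
  exact: atan_curvature_modulus.
have -> : 4 * a ^+ 2 * (`|a| + 1) * Num.min `|y - y'| 1 =
          2 * a ^+ 2 * (2 * ((`|a| + 1) * Num.min `|y - y'| 1)) by ring.
rewrite ler_wpM2l// ler_wpM2l// normrM.
have a0 : 0 <= `|a| by [].
have d0 : 0 <= `|y - y'| by [].
rewrite minr_pMr ?addr_ge0// le_min !ge_min mulr1.
apply/andP; split; apply/orP; [left; nra|right; lra].
Qed.

End sigmoid.

(** * One averaging step at a small scale *)

Section one_step.
Context {R : realType}.
Local Open Scope ereal_scope.
Implicit Types (m : probability (measurableTypeR R) R).

Definition standardized m :=
  \int[m]_y y%:E = 0 /\ \int[m]_y (y ^+ 2)%:E = 1.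

Lemma integrable_sqr m : \int[m]_y (y ^+ 2)%:E = 1 ->
  m.-integrable setT (fun y : R => (y ^+ 2)%:E).
Proof.
move=> m2; apply/integrableP; split.
  by apply/measurable_EFinP; exact: measurable_funX.
under eq_integral do rewrite gee0_abs ?lee_fin ?sqr_ge0//.
by rewrite m2 ltry.
Qed.

Lemma integrable_id m : \int[m]_y (y ^+ 2)%:E = 1 ->
  m.-integrable setT (fun y : R => y%:E).
Proof.
move=> m2.
have i1 : m.-integrable setT (fun y : R => (1 + y ^+ 2)%:E).
  apply: (@eq_integrable _ _ _ m setT measurableT
    ((EFin \o cst 1%R) \+ (fun y => (y ^+ 2)%:E))) => //.
  apply: integrableD => //; last exact: integrable_sqr.
  exact: finite_measure_integrable_cst.
apply: (le_integrable measurableT _ _ i1).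
  exact/measurable_EFinP.
move=> y _ /=; rewrite lee_fin (@ger0_norm _ (1 + y ^+ 2)%R) ?addr_ge0 ?sqr_ge0// ler_norml.
by apply/andP; split; nra.
Qed.

Lemma integrable_quadratic m (a b c : R) : standardized m ->
  m.-integrable setT (fun y : R => (a + b * y + c * y ^+ 2)%:E).
Proof.
move=> sm.
apply: (@eq_integrable _ _ _ m setT measurableT ((EFin \o cst a) \+
  (fun y => b%:E * y%:E) \+ (fun y => c%:E * (y ^+ 2)%:E))) => //.
apply: integrableD => //; last exact/integrableZl/(integrable_sqr sm.2).
apply: integrableD => //; last exact/integrableZl/(integrable_id sm.2).
exact: finite_measure_integrable_cst.
Qed.

Lemma integral_quadratic m (a b c : R) : standardized m ->
  \int[m]_y (a + b * y + c * y ^+ 2)%:E = (a + c)%:E.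
Proof.
move=> sm; have [m1 m2] := sm.
have ib : m.-integrable setT (fun y : R => b%:E * y%:E).
  exact/integrableZl/(integrable_id sm.2).
have ic : m.-integrable setT (fun y : R => c%:E * (y ^+ 2)%:E).
  exact/integrableZl/(integrable_sqr sm.2).
have ia : m.-integrable setT (EFin \o cst a : R -> _).
  exact: finite_measure_integrable_cst.
under eq_integral do rewrite EFinD EFinD 2!EFinM.
rewrite integralD//; last exact: integrableD.
rewrite integralD// integral_cst//= probability_setT mule1.
rewrite !integralZl//; [|exact: integrable_sqr sm.2|exact: integrable_id sm.2].
by rewrite m1 m2 mule0 mule1 adde0.
Qed.

(** Up to a constant factor, [h ^+ 2] times this quantity bounds the mean
    remainder of the Taylor formula for the random step [h * y]. *)
Definition truncated_moment m (h : R) := \int[m]_y (y ^+ 2 * Num.min `|h * y| 1)%:E.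

Lemma measurable_truncated_sqr (h : R) :
  measurable_fun [set: R] (fun y : R => y ^+ 2 * Num.min `|h * y| 1)%R.
Proof.
apply: measurable_funM => //.
by apply: measurable_minr => //; apply: measurableT_comp => //; exact: measurable_funM.
Qed.

Lemma truncated_sqr_ge0 (h y : R) : (0 <= y ^+ 2 * Num.min `|h * y| 1)%R.
Proof. by rewrite mulr_ge0 ?sqr_ge0// le_min normr_ge0 ler01. Qed.

Lemma truncated_sqr_le (h y : R) : (y ^+ 2 * Num.min `|h * y| 1 <= y ^+ 2)%R.
Proof. by rewrite ler_piMr ?sqr_ge0// ge_min lexx orbT. Qed.

Lemma integrable_truncated_sqr m (h : R) : standardized m ->
  m.-integrable setT (fun y : R => (y ^+ 2 * Num.min `|h * y| 1)%:E).
Proof.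
move=> sm; apply: (le_integrable measurableT _ _ (integrable_sqr sm.2)).
  by apply/measurable_EFinP; exact: measurable_truncated_sqr.
move=> y _; rewrite !gee0_abs ?lee_fin ?sqr_ge0 ?truncated_sqr_le//.
exact: truncated_sqr_ge0.
Qed.

Lemma truncated_moment_fin_num m (h : R) : standardized m ->
  truncated_moment m h \is a fin_num.
Proof. by move=> sm; apply: integrable_fin_num => //; exact: integrable_truncated_sqr. Qed.

(** Dominated convergence, the finite second moment providing the bound; this
    is a form of Lindeberg's condition. *)
Lemma truncated_moment_cvg0 m : standardized m ->
  truncated_moment m (2 ^- n) @[n --> \oo] --> 0.
Proof.
move=> sm; rewrite -(integral0 m setT) /truncated_moment.
pose t n (y : R) := (y ^+ 2 * Num.min `|2 ^- n * y| 1)%:E.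
have mt n : measurable_fun setT (t n).
  by apply/measurable_EFinP; exact: measurable_truncated_sqr.
have tsq : {ae m, forall y n, setT y -> `|t n y| <= (y ^+ 2)%:E}.
  apply/aeW => y n _; rewrite gee0_abs ?lee_fin ?truncated_sqr_le//.
  exact: truncated_sqr_ge0.
have t0 : {ae m, forall y, setT y -> t ^~ y @ \oo --> cst 0 y}.
  apply/aeW => y _; apply/cvg_EFin; first exact: nearW.
  rewrite /= -(mulr0 (y ^+ 2)%R); apply: cvgM; first exact: cvg_cst.
  have y0 : `|2 ^- n * y|%R @[n --> \oo] --> (0 : R)%R.
    rewrite -(normr0 R) -(mul0r y); apply: cvg_norm; apply: cvgMl.
    under eq_fun do rewrite -exprVn; apply: cvg_expr.
    by rewrite ger0_norm ?invr_ge0// invf_lt1// ltr1n.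
  apply: (@squeeze_cvgr _ _ _ _ (cst 0%R) (fun n => `|2 ^- n * y|%R)) => //;
    last exact: cvg_cst.
  by apply: nearW => n; rewrite le_min normr_ge0 ler01/= ge_min lexx.
have [_ _] := @dominated_convergence _ (measurableTypeR R) R m setT
  measurableT t (cst 0) (fun y : R => (y ^+ 2)%:E) mt (measurable_cst 0) t0
  (integrable_sqr sm.2) tsq.
exact.
Qed.

(** The main term [q] depends on [m] only through its mean and variance, so
    it cancels when two standardized laws are compared. *)
Lemma avg_taylor m (h x : R) (f f1 f2 : R -> R) (K : R) : standardized m ->
  m.-integrable setT (fun y => (f (x + h * y))%:E) ->
  (forall z, `|f (x + z) - (f x + z * f1 x + z ^+ 2 / 2 * f2 x)| <=
     K * (z ^+ 2 * Num.min `|z| 1))%R ->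
  let q := (f x + h ^+ 2 / 2 * f2 x)%:E in
  let r := (K * h ^+ 2 * fine (truncated_moment m h))%:E in
  avg m h (EFin \o f) x <= q + r /\ q <= avg m h (EFin \o f) x + r.
Proof.
move=> sm fi fT q r.
pose Q (y : R) := (f x + h * f1 x * y + h ^+ 2 / 2 * f2 x * y ^+ 2)%:E.
pose E (y : R) := (K * h ^+ 2 * (y ^+ 2 * Num.min `|h * y| 1))%:E.
have iQ : m.-integrable setT Q by exact: integrable_quadratic.
have iE : m.-integrable setT E.
  exact: (integrableZl measurableT _ (integrable_truncated_sqr h sm)).
have <- : \int[m]_y Q y = q by rewrite integral_quadratic.
have <- : \int[m]_y E y = r.
  rewrite /E; under eq_integral do rewrite EFinM.
  rewrite integralZl//; last exact: integrable_truncated_sqr.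
  by rewrite /r [RHS]EFinM fineK// truncated_moment_fin_num.
rewrite /avg -!integralD//.
have hT (y : R) : (`|f (x + h * y) - (f x + h * f1 x * y + h ^+ 2 / 2 * f2 x * y ^+ 2)| <=
    K * h ^+ 2 * (y ^+ 2 * Num.min `|h * y| 1))%R.
  have := fT (h * y)%R; congr (_ <= _)%R; last by ring.
  by congr `|_ - _|%R; ring.
split; apply: le_integral => //; try exact: integrableD.
  move=> y _; rewrite /Q /E /= -EFinD lee_fin.
  by have := hT y; rewrite ler_norml => /andP[_]; rewrite lerBlDl.
move=> y _; rewrite /Q /E /= -EFinD lee_fin.
by have := hT y; rewrite distrC ler_norml => /andP[_]; rewrite lerBlDl.
Qed.

End one_step.

(** * Uniqueness of the law *)

Section uniqueness.
Context {R : realType}.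
Local Open Scope ereal_scope.
Implicit Types (m : probability (measurableTypeR R) R).

Lemma measurable_sigmoid (a b : R) : measurable_fun [set: R] (sigmoid a b).
Proof. by apply: continuous_measurable_fun; exact: continuous_sigmoid. Qed.

Lemma avg_le_dyadic m1 m2 (f : R -> \bar R) n (h c : R) :
  quartering m1 -> quartering m2 -> (0 <= c)%R ->
  measurable_fun [set: R] f -> (forall x, 0 <= f x) ->
  (forall x, avg m1 (h * 2 ^- n)%R f x <= avg m2 (h * 2 ^- n)%R f x + c%:E) ->
  forall x, avg m1 h f x <= avg m2 h f x + (4 ^+ n * c)%:E.
Proof.
move=> q1 q2 c0 mf f0; elim: n h c c0 => [|n IH] h c c0 fc x.
  by have := fc x; rewrite expr0 invr1 mulr1 mul1r.
rewrite exprSr -mulrA; apply: IH; first by rewrite mulr_ge0.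
apply: avg_le_quadruple => // y.
by have := fc y; rewrite exprSr invfM -mulrA.
Qed.

(** The one-step error at scale [2 ^- n] is [4 ^- n] times a null sequence, and
    [n] quadruplings bring it to scale 1.  The statement is symmetric in [m1]
    and [m2], so an inequality is enough. *)
Lemma integral_sigmoid_le m1 m2 (a b : R) : standardized m1 -> standardized m2 ->
  quartering m1 -> quartering m2 ->
  \int[m1]_y (sigmoid a b y)%:E <= \int[m2]_y (sigmoid a b y)%:E.
Proof.
move=> s1 s2 q1 q2.
have [f1 [f2 [K K0 fT]]] := sigmoid_taylor2 a b.
pose I m n := fine (truncated_moment m (2 ^- n)).
have I0 m n : (0 <= I m n)%R.
  apply/fine_ge0/integral_ge0 => y _; rewrite lee_fin; exact: truncated_sqr_ge0.
have I_cvg m : standardized m -> I m n @[n --> \oo] --> (0 : R)%R.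
  by move=> sm; apply/fine_cvg/truncated_moment_cvg0.
have fi m (h x : R) : m.-integrable setT (fun y => (sigmoid a b (x + h * y))%:E).
  apply: (le_integrable measurableT (g := EFin \o cst pi)).
  - apply: (@measurable_shift_scale R (EFin \o sigmoid a b) h x).
    by apply/measurable_EFinP; exact: measurable_sigmoid.
  - move=> y _; rewrite /= lee_fin !ger0_norm ?sigmoid_le_pi ?sigmoid_ge0//.
    exact: pi_ge0.
  - exact: finite_measure_integrable_cst.
have step n : \int[m1]_y (sigmoid a b y)%:E <=
    \int[m2]_y (sigmoid a b y)%:E + (K * (I m1 n + I m2 n))%:E.
  pose c := (K * (2 ^- n) ^+ 2 * (I m1 n + I m2 n))%R.
  have c0 : (0 <= c)%R.
    by apply: mulr_ge0; [exact: mulr_ge0 K0 (sqr_ge0 _)|exact: addr_ge0].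
  have H : forall x, avg m1 1 (EFin \o sigmoid a b) x <=
      avg m2 1 (EFin \o sigmoid a b) x + (4 ^+ n * c)%:E.
    apply: avg_le_dyadic => //.
    - by apply/measurable_EFinP; exact: measurable_sigmoid.
    - by move=> x; rewrite lee_fin sigmoid_ge0.
    - move=> x; rewrite mul1r.
      have [+ _] := avg_taylor s1 (fi m1 (2 ^- n)%R x) (fT x).
      have [_ +] := avg_taylor s2 (fi m2 (2 ^- n)%R x) (fT x).
      move=> T2 T1; apply: (le_trans T1).
      by rewrite /c mulrDr (addrC (_ * I m1 n)%R) [X in _ <= _ + X]EFinD addeA leeD2r.
  have := H 0%R; rewrite /avg /=.
  under eq_integral do rewrite add0r mul1r.
  under [X in _ <= X + _]eq_integral do rewrite add0r mul1r.
  have -> : (4 ^+ n * c = K * (I m1 n + I m2 n))%R; last by [].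
  have -> : (4 ^+ n = (2 ^+ n) ^+ 2 :> R)%R.
    by rewrite -exprM mulnC exprM; congr (_ ^+ n)%R; ring.
  have n0 : (2 ^+ n != 0 :> R)%R by rewrite expf_neq0.
  by rewrite /c; set t := (2 ^+ n)%R in n0 *; field.
have cv : (K * (I m1 n + I m2 n))%R @[n --> \oo] --> (0 : R)%R.
  rewrite -(mulr0 K) -[X in (_ * X)%R](addr0 0%R); apply: cvgM; first exact: cvg_cst.
  by apply: cvgD; exact: I_cvg.
apply/lee_addgt0Pr => e e0.
have [n _ /(_ n (leqnn _)) /= ne] : \forall n \near \oo, (K * (I m1 n + I m2 n) < e)%R.
  by apply: (cvgr_lt _ cv).
by apply: (le_trans (step n)); rewrite leeD2l// lee_fin ltW.
Qed.

(** The argument of [atan] is [n * (n * (y - c) + 1)]: the extra [+ 1] sends it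
    to infinity also at the end point [y = c], so that the limit is exactly the
    indicator of the closed half-line. *)
Lemma sigmoid_cvg_ray (c y : R) :
  sigmoid (n%:R ^+ 2) (- n%:R ^+ 2 * c + n%:R) y @[n --> \oo] -->
  (pi * \1_(`[c, +oo[%classic : set R) y)%R.
Proof.
pose u (n : nat) : R := (n%:R * (n%:R * (y - c) + 1))%R.
have su : (fun n => sigmoid (n%:R ^+ 2) (- n%:R ^+ 2 * c + n%:R) y) =
    (fun n => atan (u n) + pi / 2)%R.
  by apply/funext => n; rewrite /sigmoid; congr (atan _ + _)%R; rewrite /u; ring.
rewrite su indicE mem_setE in_itv/= andbT.
have atan_cvg (v : nat -> R) : (\forall n \near \oo, n%:R <= v n)%R ->
    atan (v n) @[n --> \oo] --> (pi / 2)%R.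
  move=> nv; have vy : v n @[n --> \oo] --> +oo%R := ger_cvgy nv cvgr_idn.
  exact: (cvg_comp v atan (vy _) (@cvgy_atan R)).
have [cy|yc] := leP c y.
  rewrite mulr1 [X in _ --> X](splitr pi); apply: cvgD; last exact: cvg_cst.
  apply: atan_cvg; apply: nearW => n.
  by rewrite /u ler_peMr// lerDr mulr_ge0// subr_ge0.
rewrite mulr0 -(addNr (pi / 2)%R); apply: cvgD; last exact: cvg_cst.
have -> : (fun n => atan (u n)) = (fun n => - atan (- u n))%R.
  by apply/funext => n; rewrite atanN opprK.
apply: cvgN; apply: atan_cvg; near=> n.
rewrite /u -mulrN ler_peMr//.
have : (2 / (c - y) <= n%:R)%R by near: n; exact: nbhs_infty_ger.
by rewrite ler_pdivrMr ?subr_gt0//; lra.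
Unshelve. all: by end_near. Qed.

Lemma integral_sigmoid_cvg m (c : R) :
  \int[m]_y (sigmoid (n%:R ^+ 2) (- n%:R ^+ 2 * c + n%:R) y)%:E @[n --> \oo] -->
  pi%:E * m `[c, +oo[%classic.
Proof.
pose s n (y : R) := (sigmoid (n%:R ^+ 2) (- n%:R ^+ 2 * c + n%:R) y)%:E.
pose l (y : R) : \bar R := (pi * \1_(`[c, +oo[%classic : set R) y)%:E.
have ms n : measurable_fun setT (s n).
  by apply/measurable_EFinP; exact: measurable_sigmoid.
have ml : measurable_fun setT l.
  by apply/measurable_EFinP; apply: measurable_funM => //; exact: measurable_indic.
have sl : {ae m, forall y, setT y -> s ^~ y @ \oo --> l y}.
  apply/aeW => y _; apply/cvg_EFin; first exact: nearW.
  exact: sigmoid_cvg_ray.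
have s_pi : {ae m, forall y n, setT y -> `|s n y| <= (EFin \o cst pi) y}.
  apply/aeW => y n _.
  by rewrite gee0_abs ?lee_fin ?sigmoid_le_pi ?sigmoid_ge0.
have ip : m.-integrable setT (EFin \o cst pi : R -> _).
  exact: finite_measure_integrable_cst.
have [_ _] := @dominated_convergence _ (measurableTypeR R) R m setT
  measurableT s l (EFin \o cst pi) ms ml sl ip s_pi.
suff -> : pi%:E * m `[c, +oo[%classic = \int[m]_y l y by [].
rewrite /l; under eq_integral do rewrite EFinM.
rewrite ge0_integralZl//= ?integral_indic ?setIT//.
- by apply/measurable_EFinP; exact: measurable_indic.
- by rewrite lee_fin pi_ge0.
Qed.

Theorem standardized_quartering_unique m1 m2 :
  standardized m1 -> standardized m2 -> quartering m1 -> quartering m2 ->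
  forall A, measurable A -> m1 A = m2 A.
Proof.
move=> s1 s2 q1 q2.
have eq_sig (a b : R) :
    \int[m1]_y (sigmoid a b y)%:E = \int[m2]_y (sigmoid a b y)%:E.
  by apply/le_anti; rewrite !integral_sigmoid_le.
have ray (c : R) : m1 `[c, +oo[%classic = m2 `[c, +oo[%classic.
  have pm : pi%:E * m1 `[c, +oo[%classic = pi%:E * m2 `[c, +oo[%classic.
    have c1 := @integral_sigmoid_cvg m1 c.
    have c2 := @integral_sigmoid_cvg m2 c.
    suff : (fun n : nat => \int[m1]_y (sigmoid (n%:R ^+ 2) (- n%:R ^+ 2 * c + n%:R) y)%:E)
         = (fun n : nat => \int[m2]_y (sigmoid (n%:R ^+ 2) (- n%:R ^+ 2 * c + n%:R) y)%:E).
      by move=> E; rewrite E in c1; exact: cvg_unique c1 c2.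
    by apply/funext => n.
  have : pi^-1%:E * (pi%:E * m1 `[c, +oo[%classic) =
         pi^-1%:E * (pi%:E * m2 `[c, +oo[%classic) by rewrite pm.
  by rewrite !muleA -EFinM mulVf ?gt_eqF ?pi_gt0// !mul1e.
move=> A mA.
apply: (@measure_unique _ R (measurableTypeR R) (@RGenCInfty.G R)
  (fun n => `[(- n%:R)%R : R, +oo[%classic) _ _ _ _ m1 m2 _ _ A mA).
- exact: RGenCInfty.measurableE.
- move=> _ _ [x ->] [y ->]; exists (Num.max x y).
  by apply/seteqP; split => z /=; rewrite !in_itv/= !andbT ge_max => /andP.
- by move=> i; exists (- i%:R)%R.
- rewrite -subTset => x _.
  have [n xn] : exists n : nat, (`|x| <= n%:R)%R.
    by exists (Num.bound `|x|%R); rewrite ltW// archi_boundP.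
  exists n => //=; rewrite in_itv/= andbT lerNl; apply: le_trans xn.
  by rewrite -normrN ler_norm.
- by move=> _ [x ->]; exact: ray.
- by move=> k; rewrite (le_lt_trans (probability_le1 _ _))// ltry.
Qed.

End uniqueness.

(** * Laws of random variables and independence *)

Section laws.
Context d (T : measurableType d) {R : realType} (P : probability T R).
Local Open Scope ereal_scope.
Implicit Types (X Y : {RV P >-> R}).

Lemma measurable_borel X : measurable_fun [set: T] (X : T -> measurableTypeR R).
Proof.
have mX : measurable_fun [set: T] (X : T -> R) by exact: measurable_funP.
by move=> mT B mB; exact: mX.
Qed.

(** The same function, with the line carrying the sigma-algebra generated by
    the half-open intervals.  That structure and the default one on [R] have the
    same measurable sets but are different types, and Lebesgue measure is defined
    on the former. *)
Definition borel_rv X : {mfun T >-> measurableTypeR R} :=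
  @mfun_Sub _ _ T (measurableTypeR R) X (mem_set (measurable_borel X)).

Definition law X : probability (measurableTypeR R) R :=
  [the probability _ _ of distribution P (borel_rv X)].

Lemma integral_law X (g : R -> \bar R) : measurable_fun [set: R] g ->
  (forall x, 0 <= g x) -> \int[law X]_x g x = \int[P]_w g (X w).
Proof. by move=> mg g0; rewrite ge0_integral_distribution. Qed.

(** Independence identifies the law of the pair with the product law on
    rectangles, hence everywhere. *)
Lemma integral_independent_pair X Y (g : R * R -> \bar R) :
  independent_rv P X Y -> measurable_fun setT g -> (forall z, 0 <= g z) ->
  \int[P]_w g (X w, Y w) = \int[law X]_x \int[law Y]_y g (x, y).
Proof.
move=> XY mg g0.
pose RR : measurableType _ := (measurableTypeR R * measurableTypeR R)%type.
have mZ : measurable_fun [set: T] ((fun w => (X w, Y w)) : T -> RR).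
  by apply: measurable_fun_pair; exact: measurable_borel.
pose Z : {mfun T >-> RR} := @mfun_Sub _ _ T RR _ (mem_set mZ).
transitivity (\int[distribution P Z]_z g z).
  by rewrite ge0_integral_distribution.
transitivity (\int[law X \x law Y]_z g z); last by rewrite fubini_tonelli1.
apply: eq_measure_integral => A mA _; apply/esym.
apply: (product_measure_unique (m' := distribution P Z)) => // B C mB mC; exact: XY.
Qed.

Lemma avg_law X h (f : R -> \bar R) x :
  measurable_fun [set: R] f -> (forall x, 0 <= f x) ->
  avg (law X) h f x = \int[P]_w f (x + h * X w)%R.
Proof.
move=> mf f0; rewrite /avg.
exact: (@integral_law X (fun y => f (x + h * y)%R) (measurable_shift_scale h x mf)).
Qed.

Lemma avg_independent X Y (h k : R) (f : R -> \bar R) x :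
  independent_rv P X Y -> measurable_fun [set: R] f -> (forall x, 0 <= f x) ->
  avg (law X) h (avg (law Y) k f) x = \int[P]_w f (x + (h * X w + k * Y w))%R.
Proof.
move=> XY mf f0; rewrite /avg.
pose F (z : R * R) := f (x + (h * z.1 + k * z.2))%R.
have mF : measurable_fun setT F.
  apply: measurableT_comp => //; apply: measurable_funD => //.
  by apply: measurable_funD; apply: measurable_funM.
have F0 z : 0 <= F z by exact: f0.
rewrite (integral_independent_pair XY mF F0).
by apply: eq_integral => a _; apply: eq_integral => b _; rewrite /F addrA.
Qed.

Lemma avg_symmetric X h (f : R -> \bar R) : symmetric_rv P X ->
  measurable_fun [set: R] f -> (forall x, 0 <= f x) ->
  avg (law X) (- h) f = avg (law X) h f.
Proof.
move=> symX mf f0; apply/funext => x.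
transitivity (avg (law (\- X : {RV P >-> R})%R) h f x).
  by rewrite !avg_law//; apply: eq_integral => w _; rewrite mulrN mulNr.
by apply: eq_measure_integral => A mA _; exact/esym/symX.
Qed.

End laws.

(** * The common law of the two variables *)

Section bernstein.
Context d (T : measurableType d) {R : realType} (P : probability T R).
Context (X1 X2 : {RV P >-> R}).
Hypotheses (indep12 : independent_rv P X1 X2)
  (sym1 : symmetric_rv P X1) (sym2 : symmetric_rv P X2)
  (indepDB : independent_rv P (X1 \+ X2)%R (X1 \- X2)%R).
Local Open Scope ereal_scope.
Implicit Types (f : R -> \bar R) (h k : R).

Let avgD k f : measurable_fun [set: R] f -> (forall x, 0 <= f x) ->
  avg (law (X1 \+ X2 : {RV P >-> R})%R) k f = avg (law X1) k (avg (law X2) k f).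
Proof.
move=> mf f0; apply/funext => x; rewrite avg_independent// avg_law//.
by apply: eq_integral => w _; rewrite mulrDr.
Qed.

Let avgB k f : measurable_fun [set: R] f -> (forall x, 0 <= f x) ->
  avg (law (X1 \- X2 : {RV P >-> R})%R) k f = avg (law X1) k (avg (law X2) k f).
Proof.
move=> mf f0; rewrite -[in RHS](avg_symmetric k sym2)//; apply/funext => x.
rewrite avg_independent// avg_law//.
by apply: eq_integral => w _; rewrite mulrBr mulNr.
Qed.

Let avgBN k f : measurable_fun [set: R] f -> (forall x, 0 <= f x) ->
  avg (law (X1 \- X2 : {RV P >-> R})%R) (- k) f = avg (law X1) k (avg (law X2) k f).
Proof.
move=> mf f0; rewrite -[in RHS](avg_symmetric k sym1)//; first last.
- exact: avg_ge0.
- exact: measurable_avg.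
apply/funext => x; rewrite avg_independent// avg_law//.
by apply: eq_integral => w _; rewrite mulrBr !mulNr opprK.
Qed.

Let nice_avg (m : probability (measurableTypeR R) R) h g :
  measurable_fun [set: R] g /\ (forall x, 0 <= g x) ->
  measurable_fun [set: R] (avg m h g) /\ (forall x, 0 <= avg m h g x).
Proof. by move=> [mg g0]; split; [exact: measurable_avg|exact: avg_ge0]. Qed.

Let avg1 h f : measurable_fun [set: R] f -> (forall x, 0 <= f x) ->
  avg (law X1) h f = avg (law X1) (h / 2) (avg (law X2) (h / 2)
    (avg (law X1) (h / 2) (avg (law X2) (h / 2) f))).
Proof.
move=> mf f0; have [m1 p1] := nice_avg (law X2) (h / 2) (conj mf f0).
have [m2 p2] := nice_avg (law X1) (h / 2) (conj m1 p1).
rewrite -avgD//.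
rewrite -avgB//; apply/funext => x; rewrite avg_independent// avg_law//.
by apply: eq_integral => w _; congr f; rewrite /=; field.
Qed.

Let avg2 h f : measurable_fun [set: R] f -> (forall x, 0 <= f x) ->
  avg (law X2) h f = avg (law X1) (h / 2) (avg (law X2) (h / 2)
    (avg (law X1) (h / 2) (avg (law X2) (h / 2) f))).
Proof.
move=> mf f0; have [m1 p1] := nice_avg (law X2) (h / 2) (conj mf f0).
have [m2 p2] := nice_avg (law X1) (h / 2) (conj m1 p1).
rewrite -avgD//.
rewrite -avgBN//; apply/funext => x; rewrite avg_independent// avg_law//.
by apply: eq_integral => w _; congr f; rewrite /=; field.
Qed.

(** [avg1] and [avg2] have the same right-hand side, because
    [V = X1 - X2] and [- V] both have the law of [U = X1 + X2].  Thus the operators of [X1] and [X2] coincide, and the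
    right-hand side is the fourth power of either. *)
Lemma quartering_law : quartering (law X1) /\ quartering (law X2).
Proof.
have avg12 h f : measurable_fun [set: R] f -> (forall x, 0 <= f x) ->
    avg (law X1) h f = avg (law X2) h f.
  by move=> mf f0; rewrite (avg1 _ mf f0) -(avg2 _ mf f0).
have q2 : quartering (law X2).
  move=> h f mf f0.
  have [m1 p1] := nice_avg (law X2) (h / 2)  (conj mf f0).
  have [m2 p2] := nice_avg (law X2) (h / 2) (conj m1 p1).
  have [m3 p3] := nice_avg (law X2) (h / 2) (conj m2 p2).
  rewrite (avg2 _ mf f0)/=.
  by rewrite (avg12 _ _ m1 p1) (avg12 _ _ m3 p3).
split; [move=> h f mf f0|exact: q2].
have [m1 p1] := nice_avg (law X2) (h / 2)  (conj mf f0).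
have [m2 p2] := nice_avg (law X2) (h / 2) (conj m1 p1).
have [m3 p3] := nice_avg (law X2) (h / 2) (conj m2 p2).
rewrite (avg12 _ _ mf f0) (q2 _ _ mf f0)/=.
by rewrite (avg12 _ _ mf f0) (avg12 _ _ m1 p1) (avg12 _ _ m2 p2) (avg12 _ _ m3 p3).
Qed.

End bernstein.

Lemma standardized_law d (T : measurableType d) (R : realType)
    (P : probability T R) (X : {RV P >-> R}) :
  ('E_P[X] = 0)%E -> ('V_P[X] = 1)%E -> standardized (law X).
Proof.
move=> EX VX.
have m2 : (\int[law X]_y (y ^+ 2)%:E = 1)%E.
  rewrite integral_law.
  - rewrite -VX /variance unlock EX /= expectation_def.
    by apply: eq_integral => w _; rewrite /= subr0.
  - by apply/measurable_EFinP; exact: measurable_funX.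
  - by move=> y; rewrite lee_fin sqr_ge0.
split=> //.
rewrite -EX expectation_def integralE [RHS]integralE.
rewrite !integral_law//.
- by congr (_ - _)%E; apply: eq_integral => w _; rewrite ?funeposE ?funenegE.
- exact: measurable_funeneg.
- exact: measurable_funepos.
Qed.

(** * Integrals with respect to Lebesgue measure and Gaussian laws *)

Section lebesgue_affine.
Context {R : realType}.
Local Open Scope ereal_scope.
Local Notation lambda := (@lebesgue_measure R).
Implicit Types f : R -> \bar R.

(** The measure [A |-> a * lambda (phi^-1 A)], with [phi] the affine map, has the
    right value on intervals, hence is Lebesgue measure. *)
Lemma integral_lebesgue_affine (a b : R) f : (0 < a)%R ->
  measurable_fun [set: R] f -> (forall x, 0 <= f x) ->
  \int[lambda]_x f x = a%:E * \int[lambda]_x f (a * x + b)%R.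
Proof.
move=> a0 mf f0.
pose phi : measurableTypeR R -> measurableTypeR R := fun x => (a * x + b)%R.
have mphi : measurable_fun setT phi.
  by apply: measurable_funD => //; exact: measurable_funM.
pose m : {measure set (measurableTypeR R) -> \bar R} :=
  mscale (NngNum (ltW a0)) (pushforward lambda phi).
have mE A : measurable A -> lambda A = m mphi A.
  apply: lebesgue_measure_unique => _ [[c d]] _ <-.
  rewrite /m/= /mscale/= /pushforward.
  rewrite (_ : _ @^-1` _ = `]((c - b) / a)%R, ((d - b) / a)%R]%classic); last first.
    apply/seteqP; split => x; rewrite /phi /= !in_itv/= ltr_pdivrMr// ler_pdivlMr//;
      by rewrite ltrBlDr lerBrDr mulrC.
  rewrite !lebesgue_measure_itv/= !lte_fin ltr_pM2r ?invr_gt0// ltrD2r.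
  case: ifPn => _; last by rewrite mule0.
  by rewrite -!EFinD -EFinM; congr EFin; field; rewrite gt_eqF.
rewrite (eq_measure_integral (m mphi)); last by move=> A mA _; exact: mE.
rewrite ge0_integral_mscale//= ge0_integral_pushforward//.
Qed.

Lemma integral_lebesgueN f : measurable_fun [set: R] f -> (forall x, 0 <= f x) ->
  \int[lambda]_x f x = \int[lambda]_x f (- x)%R.
Proof.
move=> mf f0.
have mN : measurable_fun [set: measurableTypeR R] (-%R : _ -> measurableTypeR R) by [].
pose N :
    {measure set (measurableTypeR R) -> \bar R} :=
  pushforward lambda (-%R : _ -> measurableTypeR R).
transitivity (\int[N mN]_x f x).
  by apply: eq_measure_integral => A mA _; exact/esym/lebesgue_measureN.
by rewrite ge0_integral_pushforward.
Qed.

Lemma integral_normal_prob (m s : R) f :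
  measurable_fun [set: R] f -> (forall x, 0 <= f x) ->
  \int[normal_prob m s]_x f x = \int[lambda]_x (f x * (normal_pdf m s x)%:E).
Proof.
move=> mf f0.
(* The density is a Radon-Nikodym derivative, hence almost everywhere equal to
   the one for which the change of variables is known. *)
have dom := normal_prob_dominates m s.
have mpdf : measurable_fun [set: R] (EFin \o normal_pdf m s).
  by apply/measurable_EFinP; exact: measurable_normal_pdf.
rewrite -(Radon_Nikodym_SigmaFinite.change_of_variables dom f0 measurableT mf).
apply: ae_eq_integral => //.
- apply: emeasurable_funM => //; apply: (measurable_int lambda).
  exact: Radon_Nikodym_SigmaFinite.f_integrable.
- exact: emeasurable_funM.
- apply: ae_eqe_mul2l; apply: integral_ae_eq => //.
    exact: Radon_Nikodym_SigmaFinite.f_integrable.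
  by move=> E _ mE; rewrite -Radon_Nikodym_SigmaFinite.f_integral.
Qed.

End lebesgue_affine.

(** * Gaussian laws are stable *)

Section gaussian.
Context {R : realType}.
Local Open Scope ereal_scope.
Local Notation lambda := (@lebesgue_measure R).
Implicit Types f : R -> \bar R.

Definition gauss (s : R) : probability (measurableTypeR R) R := normal_prob 0 s.

Lemma measurable_normal_pdf_EFin (s : R) :
  measurable_fun [set: R] (fun x : R => (normal_pdf 0 s x)%:E).
Proof. by apply/measurable_EFinP; exact: measurable_normal_pdf. Qed.

Lemma measurable_normal_pdf_shift_scale (s a b : R) :
  measurable_fun [set: R] (fun x : R => (normal_pdf 0 s (a + b * x))%:E).
Proof.
apply: (@measurable_shift_scale R (EFin \o normal_pdf 0 s)).
exact: measurable_normal_pdf_EFin.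
Qed.

(** The linear map sending [(x, c * z - x)] to [(z, c * x - z)] is
    an isometry of the plane, and the joint density of two independent centred
    Gaussian variables depends only on the distance to the origin. *)
Lemma normal_pdf_rotation (s c x z : R) : s != 0%R -> (c ^+ 2 = 2)%R ->
  (normal_pdf 0 s x * normal_pdf 0 s (c * z - x) =
   normal_pdf 0 s z * normal_pdf 0 s (c * x - z))%R.
Proof.
move=> s0 c2; rewrite !normal_pdfE//.
rewrite mulrACA [RHS]mulrACA; congr (_ * _)%R.
rewrite /normal_fun -!expRD; congr expR.
rewrite -!mulrDl; congr (_ / _)%R.
rewrite !subr0 !sqrrB !exprMn c2.
ring.
Qed.

(** In the double integral of [p x * p y * f (x0 + (h / c) * (x + y))] substitute
    [y = c * z - x].  The rotation identity turns the density into
    [p z * p (c * x - z)], whose integral over [x] is [p z / c]. *)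
Lemma avg_gauss_sqrt2 (s c h : R) f : s != 0%R -> (0 < c)%R -> (c ^+ 2 = 2)%R ->
  measurable_fun [set: R] f -> (forall x, 0 <= f x) ->
  avg (gauss s) h f = avg (gauss s) (h / c) (avg (gauss s) (h / c) f).
Proof.
move=> s0 c0 c2 mf f0; apply/funext => x0.
pose p x := (normal_pdf 0 s x)%:E.
have p0 x : 0 <= p x by rewrite lee_fin normal_pdf_ge0.
have mp : measurable_fun [set: R] p.
  exact: measurable_normal_pdf_EFin.
have ma := @measurable_avg R (gauss s) (h / c)%R f mf f0.
have pa := @avg_ge0 R (gauss s) (h / c)%R f f0.
rewrite [RHS]/avg integral_normal_prob//; last exact: measurable_shift_scale.
have inner x : avg (gauss s) (h / c)%R f (x0 + h / c * x)%R =
    c%:E * \int[lambda]_z (f (x0 + h * z)%R * p (c * z + - x)%R).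
  rewrite /avg integral_normal_prob//; last exact: measurable_shift_scale.
  rewrite (integral_lebesgue_affine (- x) c0).
  - congr (_ * _); apply: eq_integral => z _; congr (f _ * _).
    by field; rewrite gt_eqF.
  - by apply: emeasurable_funM => //; exact: measurable_shift_scale.
  - by move=> y; rewrite mule_ge0 ?lee_fin ?normal_pdf_ge0.
pose F (z : measurableTypeR R * measurableTypeR R) :=
  f (x0 + h * z.2)%R * (p z.1 * p (c * z.2 + - z.1)%R).
have F0 z : 0 <= F z by rewrite !mule_ge0.
have mF : measurable_fun setT F.
  apply: emeasurable_funM.
    apply: measurableT_comp => //; apply: measurable_funD => //.
    exact: measurable_funM.
  apply: emeasurable_funM; first exact: measurableT_comp.
  apply: measurableT_comp => //; apply: measurable_funD.
    exact: measurable_funM.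
  exact: measurableT_comp.
have c0' : 0 <= c%:E by rewrite lee_fin ltW.
transitivity (\int[lambda]_x (c%:E * \int[lambda]_z F (x, z))); last first.
  apply: eq_integral => x _; rewrite inner -muleA; congr (_ * _).
  rewrite -ge0_integralZr//.
  - by apply: eq_integral => z _; rewrite /F/= -muleA (muleC (p x)).
  - apply: emeasurable_funM; first exact: measurable_shift_scale.
    have := measurable_normal_pdf_shift_scale s (- x) c.
    by under eq_fun do rewrite addrC.
  - by move=> z _; rewrite mule_ge0.
  - exact: p0.
have mFF := @measurable_fun_fubini_tonelli_F _ _ (measurableTypeR R)
  (measurableTypeR R) R lambda F mF F0.
have mFG := @measurable_fun_fubini_tonelli_G _ _ (measurableTypeR R)
  (measurableTypeR R) R lambda F mF F0.
have FF0 (u : R) : 0 <= \int[lambda]_z F (u, z) by apply: integral_ge0.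
have FG0 (w : R) : 0 <= \int[lambda]_x F (x, w) by apply: integral_ge0.
transitivity (c%:E * \int[lambda]_x \int[lambda]_z F (x, z)); last first.
  exact: (esym (@ge0_integralZl _ (measurableTypeR R) R lambda setT
    measurableT _ mFF c%:E (fun x _ => FF0 x) c0')).
rewrite (@fubini_tonelli _ _ (measurableTypeR R) (measurableTypeR R) R lambda lambda F mF F0).
transitivity (\int[lambda]_z (c%:E * \int[lambda]_x F (x, z))); last first.
  exact: (@ge0_integralZl _ (measurableTypeR R) R lambda setT
    measurableT _ mFG c%:E (fun x _ => FG0 x) c0').
rewrite /avg integral_normal_prob//; last exact: measurable_shift_scale.
apply: eq_integral => z _.
rewrite -[LHS]mule1 -[X in _ * X](@integral_normal_pdf R 0 s).
rewrite [X in _ * X](integral_lebesgue_affine (- z) c0)//.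
rewrite muleCA; congr (_ * _); rewrite -ge0_integralZl//; first last.
- by rewrite mule_ge0// lee_fin normal_pdf_ge0.
- by move=> x _; rewrite lee_fin normal_pdf_ge0.
- have := measurable_normal_pdf_shift_scale s (- z) c.
  by under eq_fun do rewrite addrC.
apply: eq_integral => x _; rewrite /F/= -muleA; congr (_ * _).
by rewrite -!EFinM normal_pdf_rotation.
Qed.

Lemma quartering_gauss (s : R) : s != 0%R -> quartering (gauss s).
Proof.
move=> s0 h f mf f0.
pose c : R := Num.sqrt 2.
have c0 : (0 < c)%R by rewrite sqrtr_gt0.
have c2 : (c ^+ 2 = 2)%R by rewrite sqr_sqrtr.
have half : (h / c / c = h / 2)%R by rewrite -c2; field; exact: lt0r_neq0.
have [m1 p1] : measurable_fun [set: R] (avg (gauss s) (h / c) f) /\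
    forall x, 0 <= avg (gauss s) (h / c) f x.
  by split; [exact: measurable_avg|exact: avg_ge0].
rewrite (avg_gauss_sqrt2 h s0 c0 c2 mf f0).
rewrite (avg_gauss_sqrt2 (h / c) s0 c0 c2 m1 p1).
rewrite (avg_gauss_sqrt2 (h / c) s0 c0 c2 mf f0).
by rewrite half.
Qed.

End gaussian.

(** * A Gaussian law with mean 0 and variance 1 *)

Section gauss_moments.
Context {R : realType}.
Local Open Scope ereal_scope.
Local Notation lambda := (@lebesgue_measure R).
Implicit Types f : R -> \bar R.

Lemma normal_pdf_scale (s x : R) : (0 < s)%R ->
  (s * normal_pdf 0 s (s * x) = normal_pdf 0 1 x)%R.
Proof.
move=> s0; rewrite !normal_pdfE ?oner_neq0 ?gt_eqF// mulrA; congr (_ * _)%R.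
  rewrite /normal_peak -!mulrnAr sqrtrM ?sqr_ge0// sqrtr_sqr gtr0_norm// expr1n mul1r.
  by rewrite invfM mulrA divff ?mul1r// gt_eqF.
rewrite /normal_fun !subr0 expr1n; congr expR.
rewrite -(mulr_natr (s ^+ 2)) exprMn -mulrN invfM mulrACA.
by rewrite divff ?mul1r ?expf_neq0 ?gt_eqF.
Qed.

Lemma normal_pdfN (s x : R) : s != 0%R -> normal_pdf 0 s (- x) = normal_pdf 0 s x.
Proof. by move=> s0; rewrite !normal_pdfE// /normal_fun !subr0 sqrrN. Qed.

Lemma integral_gaussN (s : R) f : s != 0%R ->
  measurable_fun [set: R] f -> (forall x, 0 <= f x) ->
  \int[gauss s]_x f (- x)%R = \int[gauss s]_x f x.
Proof.
move=> s0 mf f0; pose g (x : R) := f x * (normal_pdf 0 s x)%:E.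
have mg : measurable_fun [set: R] g.
  by apply: emeasurable_funM => //; exact: measurable_normal_pdf_EFin.
have g0 x : 0 <= g x by rewrite mule_ge0// lee_fin normal_pdf_ge0.
have mfN : measurable_fun [set: R] (fun x : R => f (- x)%R) by exact: measurableT_comp.
rewrite (integral_normal_prob 0 s mfN (fun x => f0 (- x)%R)).
rewrite (integral_normal_prob 0 s mf f0).
rewrite -/(g _) [RHS](integral_lebesgueN mg g0).
by apply: eq_integral => x _; rewrite /g normal_pdfN.
Qed.

Lemma measurable_sqr_EFin : measurable_fun [set: R] (fun y : R => (y ^+ 2)%:E).
Proof. by apply/measurable_EFinP; exact: measurable_funX. Qed.

Lemma sqr_EFin_ge0 (y : R) : 0 <= (y ^+ 2)%:E.
Proof. by rewrite lee_fin sqr_ge0. Qed.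

Lemma gauss_second_momentE (s : R) : \int[gauss s]_y (y ^+ 2)%:E =
  \int[lambda]_y ((y ^+ 2)%:E * (normal_pdf 0 s y)%:E).
Proof. exact: (integral_normal_prob 0 s measurable_sqr_EFin sqr_EFin_ge0). Qed.

Lemma gauss_second_moment_scale (s : R) : (0 < s)%R ->
  \int[gauss s]_y (y ^+ 2)%:E = (s ^+ 2)%:E * \int[gauss 1]_y (y ^+ 2)%:E.
Proof.
move=> s0; pose g (t x : R) := (x ^+ 2)%:E * (normal_pdf 0 t x)%:E.
have mg t : measurable_fun [set: R] (g t).
  by apply: emeasurable_funM; [exact: measurable_sqr_EFin|exact: measurable_normal_pdf_EFin].
have g0 t x : 0 <= g t x by rewrite mule_ge0// lee_fin ?sqr_ge0 ?normal_pdf_ge0.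
have mgs : measurable_fun [set: R] (fun x : R => g s (s * x + 0)%R).
  by under eq_fun do rewrite addrC; exact: measurable_shift_scale.
have s0E : 0 <= s%:E by rewrite lee_fin ltW.
have s2E : 0 <= (s ^+ 2)%:E by rewrite lee_fin sqr_ge0.
rewrite !gauss_second_momentE (integral_lebesgue_affine 0 s0 (mg s) (g0 s)).
rewrite -(@ge0_integralZl _ (measurableTypeR R) R lambda setT measurableT _ (mg 1%R)
  (s ^+ 2)%:E (fun x _ => g0 1%R x) s2E).
rewrite -(@ge0_integralZl _ (measurableTypeR R) R lambda setT measurableT _ mgs
  s%:E (fun x _ => g0 s _) s0E).
apply: eq_integral => y _; rewrite /g -!EFinM addr0 -(normal_pdf_scale y s0).
by congr EFin; ring.
Qed.

Lemma normal_pdf1E (x : R) : normal_pdf 0 1 x = (normal_peak 1 * expR (- (x ^+ 2 / 2)))%R.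
Proof.
by rewrite normal_pdfE ?oner_neq0// /normal_fun subr0 expr1n mulNr.
Qed.

Lemma gauss1_second_moment_lty : \int[gauss (1 : R)]_y (y ^+ 2)%:E < +oo.
Proof.
rewrite gauss_second_momentE.
pose c : R := Num.sqrt 2.
have c0 : (c != 0)%R by rewrite gt_eqF// sqrtr_gt0.
have c2 : (c ^+ 2 = 2)%R by rewrite sqr_sqrtr.
pose K : R := (4 * normal_peak 1 / normal_peak c)%R.
have peak0 (s : R) : (s != 0 -> 0 < normal_peak s)%R by exact: normal_peak_gt0.
have K0 : (0 <= K)%R by rewrite !mulr_ge0 ?invr_ge0 ?normal_peak_ge0.
have : lambda.-integrable setT (fun y => K%:E * (normal_pdf 0 c y)%:E).
  exact/integrableZl/integrable_normal_pdf.
move=> /integrableP[mK]; apply: le_lt_trans.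
apply: ge0_le_integral => //.
- by move=> y _; rewrite mule_ge0// lee_fin ?sqr_ge0 ?normal_pdf_ge0.
- apply: emeasurable_funM; first exact: measurable_sqr_EFin.
  exact: measurable_normal_pdf_EFin.
- exact: measurableT_comp.
(* With [u = y ^+ 2 / 4], [u * expR (- u) <= 1] bounds the integrand by a multiple
   of [expR (- u)], the Gaussian density of standard deviation [c]. *)
move=> y _; rewrite gee0_abs ?mule_ge0 ?lee_fin ?normal_pdf_ge0//.
rewrite normal_pdf1E normal_pdfE// /normal_fun subr0 c2.
have KE : (K * normal_peak c = 4 * normal_peak 1)%R.
  by rewrite /K divfK// gt_eqF// peak0.
rewrite (mulrA K) KE.
set u := (y ^+ 2 / 4)%R.
have -> : (- y ^+ 2 / (2 *+ 2) = - u)%R by rewrite /u; field.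
have -> : (- (y ^+ 2 / 2) = - u - u)%R by rewrite /u; field.
have -> : (y ^+ 2 = 4 * u)%R by rewrite /u; field.
rewrite expRD.
have ub : (u * expR (- u) <= 1)%R.
  rewrite expRN ler_pdivrMr ?expR_gt0// mul1r.
  by apply: le_trans (expR_ge1Dx u); rewrite lerDr.
have -> : (4 * u * (normal_peak 1 * (expR (- u) * expR (- u))) =
   4 * normal_peak 1 * expR (- u) * (u * expR (- u)))%R by ring.
by rewrite ler_piMr// !mulr_ge0 ?normal_peak_ge0 ?expR_ge0.
Qed.

Lemma gauss1_second_moment_gt0 : 0 < \int[gauss (1 : R)]_y (y ^+ 2)%:E.
Proof.
rewrite gauss_second_momentE.
(* On the interval [1, 2] the integrand is at least the density at 2. *)
pose q : R := normal_pdf 0 1 2.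
have q0 : (0 < q)%R.
  by rewrite /q normal_pdf1E mulr_gt0 ?expR_gt0// normal_peak_gt0 ?oner_neq0.
apply: (@lt_le_trans _ _ (\int[lambda]_y (q * \1_(`[1%R, 2%R]%classic : set R) y)%:E)).
  under eq_integral do rewrite EFinM.
  rewrite ge0_integralZl//; first last.
  - by rewrite lee_fin ltW.
  - by apply/measurable_EFinP; exact: measurable_indic.
  have l12 : lambda (`[1%R, 2%R]%classic : set R) = 1.
    by rewrite lebesgue_measure_itv/= lte_fin ltr1n -EFinB; congr EFin; ring.
  have -> : \int[lambda]_y (\1_(`[1%R, 2%R]%classic : set R) y)%:E = 1.
    by rewrite integral_indic// setIT; exact: l12.
  by rewrite mule1 lte_fin.
apply: ge0_le_integral => //.
- by move=> y _; rewrite lee_fin mulr_ge0// ltW.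
- by apply/measurable_EFinP; apply: measurable_funM => //; exact: measurable_indic.
- apply: emeasurable_funM; first exact: measurable_sqr_EFin.
  exact: measurable_normal_pdf_EFin.
move=> y _; rewrite -EFinM lee_fin indicE mem_setE in_itv/=.
have [/andP[y1 y2]|_] := boolP (1 <= y <= 2)%R; last first.
  by rewrite mulr0 mulr_ge0 ?sqr_ge0 ?normal_pdf_ge0.
rewrite mulr1 /q !normal_pdf1E mulrCA ler_wpM2l ?normal_peak_ge0//.
rewrite -[leLHS]mul1r ler_pM ?expR_ge0//; first by nra.
by rewrite ler_expR lerN2; nra.
Qed.

(** The existence of one suitable [s] is enough: it is obtained by rescaling from
    the fact that the standard Gaussian law has a positive finite second moment. *)
Lemma standardized_gauss : exists2 s : R, (0 < s)%R & standardized (gauss s).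
Proof.
pose v : R := fine (\int[gauss (1 : R)]_y (y ^+ 2)%:E).
have vE : \int[gauss (1 : R)]_y (y ^+ 2)%:E = v%:E.
  by rewrite fineK// ge0_fin_numE ?gauss1_second_moment_lty// ltW// gauss1_second_moment_gt0.
have v0 : (0 < v)%R by have := gauss1_second_moment_gt0; rewrite vE lte_fin.
have s0 : (0 < (Num.sqrt v)^-1)%R by rewrite invr_gt0 sqrtr_gt0.
exists (Num.sqrt v)^-1%R => //.
have m2 : \int[gauss (Num.sqrt v)^-1]_y (y ^+ 2)%:E = 1.
  rewrite gauss_second_moment_scale// vE -EFinM exprVn sqr_sqrtr ?ltW//.
  by rewrite mulVf// gt_eqF.
split=> //.
have mp : measurable_fun [set: R] (EFin : R -> \bar R)^\+ by exact: measurable_funepos.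
rewrite integralE.
(* The mean vanishes because the negative part of the identity is the
   reflection of its positive part. *)
have -> : \int[gauss (Num.sqrt v)^-1]_y (fun y : R => y%:E)^\- y =
          \int[gauss (Num.sqrt v)^-1]_y (EFin : R -> \bar R)^\+ (- y)%R.
  by apply: eq_integral => y _; rewrite funeposE funenegE.
rewrite integral_gaussN// ?gt_eqF//.
exact/subee/integrable_pos_fin_num/integrable_id.
Qed.

End gauss_moments.

Theorem theorem3p1 (R : realType) (d : measure_display)
    (T : measurableType d) (P : probability T R) (X1 X2 : {RV P >-> R})
    (indep12 : independent_rv P X1 X2)
    (sym1 : symmetric_rv P X1) (sym2 : symmetric_rv P X2)
    (mean1 : ('E_P[X1] = 0)%E) (mean2 : ('E_P[X2] = 0)%E)
    (var1 : ('V_P[X1] = 1)%E) (var2 : ('V_P[X2] = 1)%E)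
    (indepDB : independent_rv P (X1 \+ X2) (X1 \- X2)) :
  normal_rv P X1 /\ normal_rv P X2.
Proof.
have [q1 q2] := quartering_law indep12 sym1 sym2 indepDB.
have [s s0 sG] := @standardized_gauss R.
have qG : quartering (gauss s) by apply: quartering_gauss; rewrite gt_eqF.
have normal X : standardized (law X) -> quartering (law X) -> normal_rv P X.
  move=> sX qX; exists 0, s; split=> // A mA.
  exact: (standardized_quartering_unique sX sG qX qG mA).
by split; apply: normal => //; exact: standardized_law.
Qed.
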